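(* Let $G$ be a finite group and $H\le G$ a cyclic subgroup. Then any multiset $S$ of elements of $G$ which generates $G$ and satisfies $|S|\le [G:H]$ can be Nielsen transformed into a set contained in a left-right transversal of $H$ in $G$.
   Context: A left (resp. right) transversal of $H$ in $G$ is a set containing exactly one element of each left coset $gH$ (resp. each right coset $Hg$). A left-right transversal is a set which is simultaneously a left and a right transversal. Given a finite multiset $S$ of elements of $G$, a Nielsen move on $S$ is either (1) replacing some entry $g$ of $S$ by $g^{-1}$, or (2) replacing some entry $g$ of $S$ by $hg$ or $gh$, where $h$ is another entry of $S$ (a different occurrence in the multiset, possibly equal to $g$ as a group element). A Nielsen transformation is a finite sequence of Nielsen moves. $|S|$ is counted with multiplicity. *)

(* Defs.v *)
From mathcomp Require Export all_boot all_fingroup all_solvable.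
From mathcomp Require Export finmap multiset.
From Stdlib Require Export Relation_Operators.

Set Implicit Arguments.
Unset Strict Implicit.
Unset Printing Implicit Defensive.

Local Open Scope group_scope.
Local Open Scope mset_scope.

Section Nielsen.
Variable gT : finGroupType.
Implicit Types (S : {mset gT}) (g h : gT).

(* The side condition h \in S `\ g says that h is an occurrence in S other
   than the one being replaced: h = g is allowed only if g has multiplicity at
   least 2 in S.  In h +` A the operation is the multiset sum. *)
Inductive nielsen_move S : {mset gT} -> Prop :=
| Nielsen_inv g of g \in S :
    nielsen_move S (g^-1 +` (S `\ g))
| Nielsen_mull g h of g \in S & h \in S `\ g :
    nielsen_move S ((h * g) +` (S `\ g))
| Nielsen_mulr g h of g \in S & h \in S `\ g :
    nielsen_move S ((g * h) +` (S `\ g)).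

Definition nielsen_transformable : {mset gT} -> {mset gT} -> Prop :=
  clos_refl_trans {mset gT} nielsen_move.

Definition mset_of_set (A : {set gT}) : {mset gT} := seq_mset (enum A).

End Nielsen.

(* In MathComp lcosets H G is the set of the x *: H and rcosets H G the set of
   the H :* x, for x in G; is_transversal T P G also requires P to partition G,
   which these do when H \subset G. *)
Definition left_right_transversal (gT : finGroupType) (H G T : {set gT}) :=
  is_transversal T (lcosets H G) G && is_transversal T (rcosets H G) G.

(* Main.v *)
(* A double coset of H contains equally many left and right cosets, and each of
   its left cosets meets each of its right cosets; so every set whose elements
   lie in distinct left cosets and in distinct right cosets extends to a
   left-right transversal.  Let A be such a set contained in the current
   multiset, and b an occurrence outside A which cannot be added to A.  Then b
   shares a left or right coset with some a in A, and multiplying by a^-1 moves b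
   into H.  If A has no element in H, this new element can be added to A.
   Otherwise, H being cyclic, Euclid's algorithm turns the two elements of H into
   z and 1; the occurrences other than 1 still generate G, so 1 can be replaced
   by any element of G, in particular by one which extends A. *)
Require Import Defs.

Set Implicit Arguments.
Unset Strict Implicit.
Unset Printing Implicit Defensive.

Local Open Scope group_scope.
Local Open Scope mset_scope.

(** * Multisets and Nielsen transformations *)

Lemma size_msetD (K : choiceType) (A B : {mset K}) :
  size (A `+` B) = (size A + size B)%N.
Proof.
rewrite -size_cat -(perm_size (perm_eq_seq_mset (A ++ B))).
congr (size _); congr enum_mset; apply/msetP=> a.
by rewrite mset_seqE count_cat !count_mem_mset msetE2.
Qed.

Section Nielsen.
Variable gT : finGroupType.
Implicit Types (A B : {mset gT}) (x y : gT).

Lemma mset_of_set0 : mset_of_set (set0 : {set gT}) = mset0.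
Proof. by apply/msetP=> x; rewrite mset_seqE enum_set0 mset0E. Qed.

Lemma mset_of_setU1 (X : {set gT}) x :
  x \notin X -> mset_of_set (x |: X) = x +` mset_of_set X.
Proof.
move=> xX; rewrite /mset_of_set -mset_cons; apply/eq_seq_msetP.
apply: uniq_perm; rewrite /= ?enum_uniq ?mem_enum ?xX // => y.
by rewrite !inE !mem_enum !inE.
Qed.

Lemma size_mset_of_set (X : {set gT}) : size (mset_of_set X) = #|X|.
Proof. by rewrite (perm_size (perm_eq_seq_mset _)) cardE. Qed.

Lemma in_mset_of_set (X : {set gT}) x : (x \in mset_of_set X) = (x \in X).
Proof. by rewrite (perm_mem (perm_eq_seq_mset _)) mem_enum. Qed.

Lemma mset1D_set x B : [set y in x +` B] = x |: [set y in B].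
Proof. by apply/setP=> y; rewrite inE in_mset1D in_setU1 inE. Qed.

Lemma genU1_eq x y (X : {set gT}) :
  x \in <<y |: X>> -> y \in <<x |: X>> -> <<x |: X>> = <<y |: X>>.
Proof.
move=> xy yx; apply/eqP; rewrite eqEsubset !gen_subG.
rewrite !subUset !sub1set xy yx /=.
by rewrite !(subset_trans (subsetUr _ _) (subset_gen _)).
Qed.

(** The replaced entry is recovered from the new one and the untouched entries, so each of the two
    lies in the subgroup generated by the other and the rest. *)
Lemma nielsen_move_gen A B :
  nielsen_move A B -> <<[set x in A]>> = <<[set x in B]>>.
Proof.
have genl x (X : {set gT}) : x \in <<x |: X>> by rewrite mem_gen ?setU11.
have genr x y (X : {set gT}) : y \in X -> y \in <<x |: X>>.
  by move=> yX; rewrite mem_gen ?setU1r.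
case=> [g gA|g h gA hX|g h gA hX]; rewrite -{1}(msetB1K gA) !mset1D_set;
  set X := [set x in A `\ g].
- by apply: genU1_eq; [rewrite -groupV | rewrite groupV]; apply: genl.
- have {}hX : h \in X by rewrite in_set.
  apply: genU1_eq; last by rewrite groupM ?genl ?genr.
  by rewrite -(groupMl _ (genr (h * g) _ _ hX)) genl.
- have {}hX : h \in X by rewrite in_set.
  apply: genU1_eq; last by rewrite groupM ?genl ?genr.
  by rewrite -(groupMr _ (genr (g * h) _ _ hX)) genl.
Qed.

Lemma nielsen_gen A B :
  nielsen_transformable A B -> <<[set x in A]>> = <<[set x in B]>>.
Proof.
by elim=> {A B} [A B /nielsen_move_gen | // | A B C _ -> _ ->].
Qed.

Lemma nielsen_move_size A B : nielsen_move A B -> size A = size B.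
Proof.
by case=> [g gA|g h gA _|g h gA _];
  rewrite -{1}(msetB1K gA) !size_msetD !enum_msetn.
Qed.

Lemma nielsen_size A B : nielsen_transformable A B -> size A = size B.
Proof.
by elim=> {A B} [A B /nielsen_move_size | // | A B C _ -> _ ->].
Qed.

Lemma nielsen_trans A B C : nielsen_transformable A B ->
  nielsen_transformable B C -> nielsen_transformable A C.
Proof. exact: rt_trans. Qed.

Lemma nielsen_move_mull x y B :
  y \in B -> nielsen_move (x +` B) ((y * x) +` B).
Proof.
by have := Nielsen_mull (h := y) (mset1D1 x B); rewrite msetD1K.
Qed.

Lemma nielsen_move_mulr x y B :
  y \in B -> nielsen_move (x +` B) ((x * y) +` B).
Proof.
by have := Nielsen_mulr (h := y) (mset1D1 x B); rewrite msetD1K.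
Qed.

(** In a finite group [w] is a product of elements of [B] without inverses, so [x] can absorb its
    letters one by one while [B] stays fixed. *)
Lemma nielsen_mul_gen x w B : w \in <<[set y in B]>> ->
  nielsen_transformable (x +` B) ((x * w) +` B).
Proof.
case/gen_prodgP=> n [c cB ->]; elim: n c cB => [|n IHn] c cB.
  by rewrite big_ord0 mulg1; apply: rt_refl.
rewrite big_ord_recr mulgA /=; apply: nielsen_trans.
  by apply: (IHn (fun i => c (widen_ord (leqnSn n) i))) => i; apply: cB.
by apply: rt_step; apply: nielsen_move_mulr; have := cB ord_max; rewrite in_set.
Qed.

Lemma nielsen_gen_mul x w B : w \in <<[set y in B]>> ->
  nielsen_transformable (x +` B) ((w * x) +` B).
Proof.
case/gen_prodgP=> n [c cB ->]; elim: n c cB => [|n IHn] c cB.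
  by rewrite big_ord0 mul1g; apply: rt_refl.
rewrite big_ord_recl -mulgA /=; apply: nielsen_trans.
  by apply: (IHn (fun i => c (lift ord0 i))) => i; apply: cB.
by apply: rt_step; apply: nielsen_move_mull; have := cB ord0; rewrite in_set.
Qed.

(* Euclid's algorithm on the exponents. *)
Lemma nielsen_cyclic c x y B : x \in <[c]> -> y \in <[c]> ->
  exists2 z, z \in <[c]> & nielsen_transformable (x +` (y +` B)) (z +` (1 +` B)).
Proof.
case/cycleP=> i -> /cycleP[j ->] {x y}.
have [n] := ubnP (i + j); elim: n i j => // n IHn i j.
wlog le_ij : i j / i <= j => [wlog_ij|].
  have [|/ltnW le_ji] := leqP i j; first exact: wlog_ij.
  by rewrite addnC msetDCA; apply: wlog_ij.
case: i le_ij => [_ _|i le_ij lt_n].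
  by exists (c ^+ j); rewrite ?mem_cycle // msetDCA; apply: rt_refl.
(* Dividing the larger power by the smaller lowers the exponent sum to [j], because [i.+1] is
   positive. *)
have [|z zc IH] := IHn i.+1 (j - i.+1)%N.
  by rewrite subnKC // -ltnS (leq_trans _ lt_n) // addSn !ltnS leq_addl.
exists z => //; apply: nielsen_trans IH.
rewrite msetDCA [X in nielsen_transformable _ X]msetDCA.
have -> : c ^+ (j - i.+1) = c ^+ j * (c ^+ i.+1)^-1.
  by rewrite -{2}(subnK le_ij) expgD mulgK.
apply: nielsen_mul_gen.
by rewrite groupV mem_gen // in_set mset1D1.
Qed.

End Nielsen.

(** * Partial left-right transversals *)

Section Separated.
Variable gT : finGroupType.
Implicit Types (G H : {group gT}) (A B T : {set gT}).

(** The disjuncts mean [aH = bH] and [Ha = Hb]: within [G], these are the partial left-right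
    transversals. *)
Definition coset_separated H A :=
  {in A &, forall a b, (a^-1 * b \in H) || (a * b^-1 \in H) -> a = b}.

Lemma coset_separated0 H : coset_separated H set0.
Proof. by move=> a b; rewrite inE. Qed.

Lemma coset_separatedS H A B :
  A \subset B -> coset_separated H B -> coset_separated H A.
Proof. by move=> /subsetP sAB sepB a b /sAB aB /sAB; apply: sepB. Qed.

Lemma coset_separatedU1 H A g : coset_separated H A ->
  {in A, forall a, (a^-1 * g \notin H) && (g * a^-1 \notin H)} ->
  coset_separated H (g |: A).
Proof.
move=> sepA gA a b; rewrite !inE.
case/predU1P=> [->|aA] /predU1P[->|bA] //; last exact: sepA.
  have /andP[/negPf nL /negPf nR] := gA b bA.
  by rewrite -groupV invMg invgK nL nR.
have /andP[/negPf nL /negPf nR] := gA a aA.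
by rewrite nL -groupV invMg invgK nR.
Qed.

(** If [a * h = b * k], then [a] and [b] share a left coset; hence multiplication is injective on
    pairs. *)
Lemma card_separated_mulg H A : coset_separated H A ->
  #|A * H| = (#|A| * #|H|)%N.
Proof.
move=> sepA; rewrite -cardsX /mulg /= /set_mulg curry_imset2X card_in_imset //.
move=> [a h] [b k]; rewrite !inE /= => /andP[aA hH] /andP[bA kH] eq_ab.
have ab : a = b.
  apply: sepA => //; apply/orP; left.
  suff -> : a^-1 * b = h * k^-1 by rewrite groupM ?groupV.
  by apply: (mulgI a); rewrite mulKVg mulgA eq_ab mulgK.
by rewrite ab in eq_ab *; rewrite (mulgI _ _ _ eq_ab).
Qed.

(** Inversion exchanges left and right cosets; this carries the count of [A * H] over to [H * A]. *)
Lemma coset_separatedV H A : coset_separated H A -> coset_separated H A^-1.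
Proof.
move=> sepA a b; rewrite !inE => aA bA; rewrite orbC => eq_ab.
by apply: invg_inj; apply: sepA; rewrite ?invgK.
Qed.

(* Choose x in G outside A H.  Inside D = H x H the sets (A :&: D) H and
   H (A :&: D) are disjoint unions of equally many cosets, and the first misses
   x, so the second misses some y = h x k; then h^-1 y lies in x H and H y. *)
Lemma coset_separated_extend G H A : H \subset G -> coset_separated H A ->
  #|A| < #|G : H| ->
  exists2 g, g \in G & g \notin A /\ coset_separated H (g |: A).
Proof.
move=> sHG sepA ltA.
have [x xG xAH] : exists2 x, x \in G & x \notin A * H.
  apply/subsetPn; apply: contraL ltA => /subset_leq_card.
  by rewrite card_separated_mulg // -leqNgt -(Lagrange sHG) mulnC leq_pmul2r.
pose D := H * [set x] * H.
have HD : H * D = D by rewrite /D !mulgA mulGid.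
have DH : D * H = D by rewrite /D -mulgA mulGid.
have sepAD : coset_separated H (A :&: D).
  by apply: coset_separatedS sepA; apply: subsetIl.
have xD : x \in D.
  by rewrite -(mulg1 x) -(mul1g x) !mem_mulg ?set11.
have [y yD yHA] : exists2 y, y \in D & y \notin H * (A :&: D).
  apply/subsetPn; apply/negP => /subset_leq_card; apply/negP; rewrite -ltnNge.
  have -> : #|H * (A :&: D)| = #|(A :&: D) * H|.
    rewrite [RHS]card_separated_mulg // -card_invg invMg invGid.
    by rewrite card_separated_mulg ?card_invg //; apply: coset_separatedV.
  apply: proper_card; apply/properP; split.
    by rewrite -{2}DH mulSg ?subsetIr.
  exists x => //; apply: contra xAH.
  by apply: subsetP; apply: mulSg; apply: subsetIl.
have /mulsgP[u k /mulsgP[h x' hH /set1P-> ->] kH def_y] := yD.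
exists (x * k); first by rewrite groupM // (subsetP sHG).
have gA : {in A, forall a, (a^-1 * (x * k) \notin H) && (x * k * a^-1 \notin H)}.
  move=> a aA; apply/andP; split.
    apply: contra xAH => aH; rewrite -[x](mulgK k) -[x * k](mulKVg a).
    by rewrite -mulgA mem_mulg // groupM ?groupV.
  (* A shared right coset puts [a] in [H y], hence in [D]; this is why avoiding [H * (A :&: D)] is
     enough. *)
  apply: contra yHA => Ha.
  have def_a : a = (x * k * a^-1)^-1 * h^-1 * y.
    by rewrite def_y !invMg !invgK !mulgA mulgKV mulgKV mulgKV.
  have aD : a \in D.
    by rewrite def_a -HD mem_mulg // groupM ?groupV.
  have -> : y = h * (x * k * a^-1) * a by rewrite def_y !mulgA mulgKV.
  by rewrite mem_mulg ?inE ?aA // groupM.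
split; last exact: coset_separatedU1.
by apply: contraTN isT => /gA; rewrite mulVg group1.
Qed.

Lemma lcosets_partition G H : H \subset G -> partition (lcosets H G) G.
Proof.
move=> sHG; suff -> : lcosets H G = preim_partition (fun x => x *: H) G.
  exact: preim_partitionP.
apply/eq_in_imset => x xG; apply/setP=> y.
rewrite inE /= lcosetE (sameP eqP lcoset_eqP) lcoset_sym andb_idl //.
by case/lcosetP=> h hH ->; rewrite groupM // (subsetP sHG).
Qed.

(** Counting forces [T * H = G = H * T], so [T] meets every coset; separation makes the point
    unique. *)
Lemma coset_separated_transversal G H T : H \subset G -> T \subset G ->
  coset_separated H T -> #|T| = #|G : H| -> left_right_transversal H G T.
Proof.
move=> sHG sTG sepT cardT.
have TH : T * H = G.
  apply/eqP; rewrite eqEcard mul_subG //= card_separated_mulg //.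
  by rewrite cardT mulnC Lagrange.
have HT : H * T = G.
  apply/eqP; rewrite eqEcard mul_subG //= -(card_invg (H * T)) invMg invGid.
  rewrite card_separated_mulg; last exact: coset_separatedV.
  by rewrite card_invg cardT mulnC Lagrange.
apply/andP; split; apply/and3P; split=> //.
- exact: lcosets_partition.
- apply/forall_inP=> _ /lcosetsP[g gG ->]; rewrite -TH in gG.
  have /mulsgP[t h tT hH ->] := gG; apply/cards1P; exists t; apply/setP=> s.
  rewrite !inE mem_lcoset invMg -mulgA groupMl ?groupV //.
  apply/andP/eqP=> [[sT st]|->]; last by rewrite mulVg.
  by symmetry; apply: sepT => //; rewrite st.
- exact: rcosets_partition.
- apply/forall_inP=> _ /rcosetsP[g gG ->]; rewrite -HT in gG.
  have /mulsgP[h t hH tT ->] := gG; apply/cards1P; exists t; apply/setP=> s.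
  rewrite !inE mem_rcoset invMg mulgA groupMr ?groupV //.
  apply/andP/eqP=> [[sT st]|->]; last by rewrite mulgV.
  by apply: sepT => //; rewrite st orbT.
Qed.

Lemma coset_separated_sub_transversal G H A : H \subset G -> A \subset G ->
  coset_separated H A -> #|A| <= #|G : H| ->
  exists2 T : {set gT}, left_right_transversal H G T & A \subset T.
Proof.
move=> sHG; have [n] := ubnP (#|G : H| - #|A|).
elim: n A => // n IHn A ltn sAG sepA; rewrite leq_eqVlt => /predU1P[eqA|ltA].
  by exists A => //; apply: coset_separated_transversal.
have [g gG [gA sepgA]] := coset_separated_extend sHG sepA ltA.
have cgA : #|g |: A| = #|A|.+1 by rewrite cardsU1 gA.
have [||||T TT /(subset_trans (subsetUr _ _))] := IHn (g |: A); rewrite ?cgA //.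
- by rewrite -ltnS (leq_trans _ ltn) // ltnS subnS prednK ?subn_gt0.
- by rewrite subUset sub1set gG.
- by exists T.
Qed.

End Separated.

(** * Enlarging the separated part of the multiset *)

Section Step.
Variables (gT : finGroupType) (G H : {group gT}).
Hypotheses (sHG : H \subset G) (cycH : cyclic H).
Implicit Types (A : {set gT}) (B S : {mset gT}).

(** An obstruction is some [a] in [A] with [a^-1 * b] or [b * a^-1] in [H], and [a^-1] lies in the
    subgroup generated by the other occurrences. *)
Lemma nielsen_separated_or_subgroup A B b : coset_separated H A ->
  (b \notin A /\ coset_separated H (b |: A)) \/
  exists2 h, h \in H & nielsen_transformable
    (b +` (mset_of_set A `+` B)) (h +` (mset_of_set A `+` B)).
Proof.
move=> sepA.
have [/exists_inP[a aA]|/exists_inPn nA] :=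
    boolP [exists a in A, (a^-1 * b \in H) || (b * a^-1 \in H)].
  have a_gen : a^-1 \in <<[set y in mset_of_set A `+` B]>>.
    by rewrite groupV mem_gen // in_set in_msetD in_mset_of_set aA.
  case/orP=> hH; right; first by exists (a^-1 * b); last exact: nielsen_gen_mul.
  by exists (b * a^-1); last exact: nielsen_mul_gen.
have gA : {in A, forall a, (a^-1 * b \notin H) && (b * a^-1 \notin H)}.
  by move=> a /nA; rewrite negb_or.
left; split; last exact: coset_separatedU1.
by apply: contraTN isT => /gA; rewrite mulVg group1.
Qed.

Lemma nielsen_separated_step A B b :
  coset_separated H A -> #|A| < #|G : H| ->
  <<[set x in b +` (mset_of_set A `+` B)]>> = G ->
  exists A', [/\ coset_separated H A', #|A'| = #|A|.+1 &
    nielsen_transformable (b +` (mset_of_set A `+` B)) (mset_of_set A' `+` B)].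
Proof.
move=> sepA ltA genG.
(* [A1] may differ from [A], since Euclid's algorithm can change one element of [A]. *)
have add_elt A1 h : #|A1| = #|A| -> h \notin A1 -> coset_separated H (h |: A1) ->
    nielsen_transformable (b +` (mset_of_set A `+` B))
                          (h +` (mset_of_set A1 `+` B)) ->
  exists A', [/\ coset_separated H A', #|A'| = #|A|.+1 &
    nielsen_transformable (b +` (mset_of_set A `+` B)) (mset_of_set A' `+` B)].
  move=> cA1 hA sephA NT; exists (h |: A1).
  by rewrite cardsU1 hA cA1 mset_of_setU1 // -msetDA.
have [[bA sepbA]|[h hH NTh]] := nielsen_separated_or_subgroup B b sepA.
  by apply: add_elt sepbA _; last exact: rt_refl.
have [/exists_inP[a aA aH]|/exists_inPn nAH] := boolP [exists a in A, a \in H].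
  (* [H] is itself a coset, so [a] is the only element of [A] in it. *)
  have HA u : u \in A :\ a -> u \notin H.
    case/setD1P=> ua uA; apply: contra ua => uH; apply/eqP.
    by apply: sepA; rewrite ?groupM ?groupV.
  have [c defH] := cyclicP cycH.
  have [||z zH NTz] :=
      nielsen_cyclic (c := c) (x := h) (y := a) (mset_of_set (A :\ a) `+` B).
  - by rewrite -defH.
  - by rewrite -defH.
  rewrite -defH in zH.
  have zA : z \notin A :\ a by apply: contraL zH => /HA.
  have cA1 : #|z |: A :\ a| = #|A| by rewrite cardsU1 zA (cardsD1 a A) aA.
  have sepz : coset_separated H (z |: A :\ a).
    apply: coset_separatedU1.
      by apply: coset_separatedS sepA; apply: subsetDl.
    by move=> u /HA; rewrite groupMr // groupMl // groupV => ->.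
  (* The entries [h] and [a] become [1] and [z], with [z] taking the place of [a]. *)
  have {NTz}NTz : nielsen_transformable (b +` (mset_of_set A `+` B))
                            (1 +` (mset_of_set (z |: A :\ a) `+` B)).
    apply: nielsen_trans NTh _; rewrite -{1}(setD1K aA).
    by rewrite !mset_of_setU1 ?setD11 // -!msetDA (msetDCA [mset 1]).
  have [|g gG [gA sepg]] := coset_separated_extend sHG sepz.
    by rewrite cA1.
  apply: (add_elt _ g cA1 gA sepg); apply: (nielsen_trans NTz).
  rewrite -(mulg1 g); apply: nielsen_gen_mul.
  (* Dropping the entry [1] leaves a generating multiset, so [1] can be multiplied by any [g] in
     [G]. *)
  have /nielsen_gen := NTz; rewrite genG mset1D_set => defG.
  suff <- : G :=: <<[set y in mset_of_set (z |: A :\ a) `+` B]>> by [].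
  rewrite defG; apply/eqP; rewrite eqEsubset !gen_subG subUset sub1set group1.
  by rewrite subset_gen (subset_trans (subsetUr _ _) (subset_gen _)).
(* Here [A] avoids [H], and an element of [H] shares no coset with an element outside [H]. *)
apply: add_elt NTh => //; first by apply: contraL hH => /nAH.
apply: coset_separatedU1 => // u /nAH.
by rewrite groupMr // groupMl // groupV => ->.
Qed.

Lemma nielsen_separated S k : <<[set x in S]>> = G -> size S <= #|G : H| ->
  k <= size S ->
  exists A B, [/\ coset_separated H A, #|A| = k &
    nielsen_transformable S (mset_of_set A `+` B)].
Proof.
move=> genG leS; elim: k => [_|k IHk lt_k].
  exists set0, S; rewrite cards0 mset_of_set0 mset0D.
  by split; [apply: coset_separated0 | | apply: rt_refl].
have [A [B [sepA cA NT]]] := IHk (ltnW lt_k).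
(* Nielsen moves preserve size, so an empty [B] would give [size S = k]. *)
case: (mset_0Vmem B) => [B0|[b bB]].
  move: lt_k; rewrite (nielsen_size NT) B0 msetD0 size_mset_of_set cA.
  by rewrite ltnn.
rewrite -(msetB1K bB) msetDCA in NT.
have [||A' [sepA' cA' NT']] := nielsen_separated_step (B := B `\ b) (b := b) sepA.
- by rewrite cA (leq_trans lt_k).
- by rewrite -(nielsen_gen NT).
- by exists A', (B `\ b); split; rewrite ?cA' ?cA //; apply: nielsen_trans NT'.
Qed.

End Step.

Theorem theorem5p7 (gT : finGroupType) (G H : {group gT}) (S : {mset gT}) :
  H \subset G -> cyclic H ->
  <<[set x in S]>> = G ->
  size S <= #|G : H| ->
  exists A T : {set gT},
    [/\ nielsen_transformable S (mset_of_set A),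
        left_right_transversal H G T
      & A \subset T].
Proof.
move=> sHG cycH genG leS.
have [A [B [sepA cA NT]]] := nielsen_separated sHG cycH genG leS (leqnn _).
(* [A] already has [size S] elements, which leaves none for [B]. *)
have B0 : B = mset0.
  apply/eqP; rewrite -size_mset_eq0 -(eqn_add2l #|A|) addn0 {2}cA.
  by rewrite (nielsen_size NT) size_msetD size_mset_of_set.
rewrite B0 msetD0 in NT.
have sAG : A \subset G.
  rewrite -genG (nielsen_gen NT); apply/subsetP=> x xA.
  by rewrite mem_gen // in_set in_mset_of_set.
have [|T TT sAT] := coset_separated_sub_transversal sHG sAG sepA.
  by rewrite cA.
by exists A, T.
Qed.
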